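(* Let $t\geq 2$ and let $m_1,m_2$ and $n_1,\ldots,n_t$ be positive integers such that $m_2\geq n_i\geq 2 \lceil \log (35^{2^{t}-2}(32m_1+49m_2))\rceil+2$ for each $1\leq i\leq t$. Then $$R(C_{n_1},\ldots,C_{n_t},K_{m_1,m_2})\leq 35^{2^{t}-2}(32m_1+49m_2).$$
   Context: $C_k$ denotes the cycle on $k$ vertices and $K_{a,b}$ the complete bipartite graph with parts of sizes $a$ and $b$. For graphs $G_1,\ldots,G_k$, the Ramsey number $R(G_1,\ldots,G_k)$ is the smallest integer $N$ such that for every coloring of the edges of the complete graph $K_N$ with colors $1,\ldots,k$ there is, for some $i$, a copy of $G_i$ all of whose edges have color $i$. $\log$ denotes the logarithm to base $2$. *)

(* Defs.v *)
From mathcomp Require Import all_boot.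
Set Implicit Arguments. Unset Strict Implicit. Unset Printing Implicit Defensive.

Record sgraph := SGraph { vert : finType; adj : rel vert }.

Definition cycle_graph (n : nat) : sgraph :=
  @SGraph 'I_n (fun u v : 'I_n => (val v == (val u).+1 %% n) || (val u == (val v).+1 %% n)).

Definition Kbip (a b : nat) : sgraph :=
  @SGraph ('I_a + 'I_b)%type
    (fun u v => match u, v with
                | inl _, inr _ => true
                | inr _, inl _ => true
                | _, _ => false end).

(* An edge coloring of K_N with k colors: a symmetric function on pairs
   of vertices (the value on the diagonal is irrelevant). *)
Definition edge_coloring (N k : nat) (c : 'I_N -> 'I_N -> 'I_k) : Prop :=
  forall x y, c x y = c y x.

Definition mono_copy (N k : nat) (c : 'I_N -> 'I_N -> 'I_k) (G : sgraph) (i : 'I_k) : Prop :=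
  exists f : vert G -> 'I_N, injective f /\
    forall u v : vert G, adj u v -> c (f u) (f v) = i.

Definition ramsey_prop (k : nat) (G : 'I_k -> sgraph) (N : nat) : Prop :=
  forall c : 'I_N -> 'I_N -> 'I_k, edge_coloring c -> exists i : 'I_k, mono_copy c (G i) i.

(* R(G_0,...,G_(k-1)) <= M  iff the least N with the Ramsey property is <= M,
   i.e. some N <= M has the Ramsey property. *)
Definition ramsey_le (k : nat) (G : 'I_k -> sgraph) (M : nat) : Prop :=
  exists N, N <= M /\ ramsey_prop G N.

(* The family C_{n_1},...,C_{n_t},K_{m1,m2}, indexed by 'I_(t+1);
   n is 0-indexed: n 0, ..., n (t-1). *)
Definition cyc_bip_family (t : nat) (n : nat -> nat) (m1 m2 : nat) : 'I_t.+1 -> sgraph :=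
  fun i => if val i < t then cycle_graph (n (val i)) else Kbip m1 m2.
Arguments cyc_bip_family : clear implicits.

(* Main.v *)
Require Import Defs.
From mathcomp Require Import all_boot.
From mathcomp Require Import zify.
Set Implicit Arguments. Unset Strict Implicit. Unset Printing Implicit Defensive.

(** Induction on the number t of cycle colours, with bounds F_0 = 2 and F_(t+1) = F_t (25 + F_t)
    (times m = max(m1, m2)). Given t + 1 cycle colours, treat colour t as part of the bipartite
    colour: the induction hypothesis yields large disjoint sets X and Y with no edge of the first
    t colours between them. If colour t misses an m x m pair between X and Y, that pair is the
    required complete bipartite graph. Otherwise colour t between X and Y is an expander up to
    few vertices: from the neighbours of a typical vertex of X, breadth-first search in two
    disjoint expanding pieces reaches more than m vertices after few steps, and a path of
    prescribed length in a third piece links the two levels. This gives every even cycle length,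
    and an edge of colour t between two typical vertices of X gives every odd one. So either the
    cycle is found or the typical vertices of X span no edge of colour t, and the induction
    hypothesis applies to them. *)

(** * Cardinalities of finite sets *)

Section Subsets.
Variable V : finType.
Implicit Types A B S : {set V}.

Lemma subset_of_card A k : k <= #|A| -> exists2 B : {set V}, B \subset A & #|B| = k.
Proof.
move=> kA; exists [set x in take k (enum A)].
  by apply/subsetP=> x; rewrite inE => /mem_take; rewrite mem_enum.
have /card_uniqP := take_uniq k (enum_uniq A).
by rewrite cardsE => ->; rewrite size_takel // -cardE.
Qed.

Lemma cards_addU A B : #|A :|: B| = #|A| + #|B :\: A|.
Proof.
rewrite cardsU cardsD [B :&: A]setIC.
by have := subset_leq_card (subsetIr A B); lia.
Qed.

End Subsets.

(** * Neighbourhoods, breadth-first balls and depth-first search *)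

Section Graph.
Variables (V : finType) (e : rel V).
Implicit Types (A B S Z W : {set V}) (s p : seq V).

Definition nbrs S := [set v | [exists u in S, e u v]].

Lemma nbrsP S v : reflect (exists2 u, u \in S & e u v) (v \in nbrs S).
Proof. by rewrite inE; apply: (iffP exists_inP). Qed.

Lemma nbrsS A B : A \subset B -> nbrs A \subset nbrs B.
Proof. by move/subsetP=> sAB; apply/subsetP=> v /nbrsP[u /sAB uB euv]; apply/nbrsP; exists u. Qed.

Lemma nbrsU A B : nbrs (A :|: B) = nbrs A :|: nbrs B.
Proof.
apply/setP=> v; rewrite in_setU; apply/nbrsP/orP.
  by case=> u /setUP[uA|uB] euv; [left|right]; apply/nbrsP; exists u.
by case=> /nbrsP[u uS euv]; exists u; rewrite // inE uS ?orbT.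
Qed.

Fixpoint ball W r j : {set V} :=
  if j is i.+1 then ball W r i :|: (nbrs (ball W r i) :&: W) else [set r].

(** Only neighbours outside [S] count, so a ball of size at most [k] at least doubles at the next
    radius. *)
Definition expands W k :=
  forall S, S \subset W -> S != set0 -> #|S| <= k -> #|S| <= #|(nbrs S :&: W) :\: S|.

Lemma ball_sub W r j : r \in W -> ball W r j \subset W.
Proof.
move=> rW; elim: j => [|j IH] /=; first by rewrite sub1set.
by rewrite subUset IH subsetIr.
Qed.

Lemma ball_center W r j : r \in ball W r j.
Proof. by elim: j => [|j IH] /=; rewrite inE ?IH. Qed.

(* Each vertex of the path lies on a new level, so the path is simple. *)
Lemma ball_level_path W r j v : r \in W -> v \in ball W r j.+1 :\: ball W r j ->
  exists p, [/\ path e r p, last r p = v, size p = j.+1, uniq (r :: p)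
    & {subset r :: p <= ball W r j.+1}].
Proof.
move=> rW; elim: j v => [|j IH] v /setDP[].
  move=> /setUP[->//|/setIP[/nbrsP[u /set1P-> erv] vW]] vr.
  exists [:: v]; split=> //=; rewrite ?erv //= ?inE.
    by rewrite andbT eq_sym; move: vr; rewrite inE.
  move=> x; rewrite !inE => /orP[->//|/eqP->].
  by rewrite vW andbT; apply/orP; right; apply/exists_inP; exists r; rewrite ?inE.
move=> /setUP[->//|/setIP[/nbrsP[u ub euv] vW]] vb.
have ubj : u \notin ball W r j.
  apply: contra vb => ubj /=; rewrite inE; apply/orP; right; rewrite inE vW andbT.
  by apply/nbrsP; exists u.
have [|p [pp lp sp up inp]] := IH u; first by rewrite inE ubj.
exists (rcons p v); split.
- by rewrite rcons_path pp lp.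
- by rewrite last_rcons.
- by rewrite size_rcons sp.
- rewrite -rcons_cons rcons_uniq up andbT; apply: contra vb; exact: inp.
move=> x; rewrite -rcons_cons mem_rcons inE => /orP[/eqP->|xp].
  rewrite /= in_setU; apply/orP; right; rewrite in_setI vW andbT.
  by apply/nbrsP; exists u.
by apply/setUP; left; apply: inp.
Qed.

(** Balls double until they have [2 * m] vertices, hence reach this size by radius [d]. At the first
    such radius the new level is at least as large as the ball inside it, so it has at least [m]
    vertices. *)
Lemma expands_level W m r d : 0 < m -> 2 * m <= 2 ^ d -> r \in W -> expands W (2 * m) ->
  exists j, exists L : {set V}, [/\ j <= d, L \subset W, m <= #|L|
    & forall v, v \in L -> exists p, [/\ path e r p, last r p = v, size p = j,
        uniq (r :: p) & {subset r :: p <= W}]].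
Proof.
move=> m0 md rW exW.
have b0 j : ball W r j != set0 by apply/set0Pn; exists r; apply: ball_center.
have cb j : #|ball W r j.+1| = #|ball W r j| + #|(nbrs (ball W r j) :&: W) :\: ball W r j|.
  by rewrite /= cards_addU.
have grow j : 2 * m <= #|ball W r j| \/ 2 ^ j <= #|ball W r j|.
  elim: j => [|j IH]; first by right; rewrite cards1.
  have [big|small] := leqP (2 * m) #|ball W r j|; first by left; rewrite cb; lia.
  right; case: IH => [|IH]; first by lia.
  by have := exW _ (ball_sub j rW) (b0 j) (ltnW small); rewrite cb expnS; lia.
have exj : exists j, 2 * m <= #|ball W r j|.
  by exists d; case: (grow d) => // ?; lia.
case: (ex_minnP exj) => [[|j] bigj minj]; first by move: bigj; rewrite cards1; lia.
have smallj : #|ball W r j| < 2 * m.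
  by rewrite ltnNge; apply/negP=> /minj; rewrite ltnn.
exists j.+1, (ball W r j.+1 :\: ball W r j); split.
- by apply: minj; case: (grow d) => // ?; lia.
- by apply: subset_trans (ball_sub j.+1 rW); apply: subsetDl.
- have := exW _ (ball_sub j rW) (b0 j) (ltnW smallj).
  move: bigj; rewrite cb /= setDUl setDv set0U; lia.
move=> v vL; have [p [pp lp sp up inp]] := ball_level_path rW vL.
by exists p; split=> // x /inp; apply: (subsetP (ball_sub _ rW)).
Qed.


(** On the empty stack every vertex is allowed: the search restarts there. *)
Definition extends_path s v := if s is x :: _ then e x v else true.

(* Invariant of depth-first search with stack s (top first) and set D of finished vertices. *)
Lemma dfs_state W k d : symmetric e -> 0 < k -> d <= #|W| ->
  (exists s, [/\ uniq s, sorted e s, {subset s <= W} & size s = k]) \/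
  exists (D : {set V}) s, [/\ D \subset W, #|D| = d & size s < k] /\
    [/\ uniq s, sorted e s, {subset s <= W :\: D}
     & forall u v, u \in D -> v \in W -> v \notin D -> v \notin s -> ~~ e u v].
Proof.
move=> sym_e k0; elim: d => [|d IH] dW.
  right; exists set0, [::]; rewrite sub0set cards0; split=> //; split=> // u v.
  by rewrite inE.
case: (IH (ltnW dW)) => [|[D [s [[DW cD sk] [us ps sW noD]]]]]; first by left.
(* Vertices are pushed until the stack has size [k] or its top has no new neighbour; in the latter
   case the top is popped and becomes the next finished vertex. *)
have [f] := ubnP (k - size s); elim: f s sk us ps sW noD => // f IHf s sk us ps sW noD fk.
have [/existsP[v /and4P[vW vD vs ev]]|/existsPn nov] := boolP
  [exists v, [&& v \in W, v \notin D, v \notin s & extends_path s v]].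
  have uvs : uniq (v :: s) by rewrite /= vs.
  have pvs : sorted e (v :: s).
    by case: (s) ev ps => //= x s' exv ->; rewrite sym_e exv.
  have svs : {subset v :: s <= W :\: D}.
    by move=> x; rewrite inE => /orP[/eqP->|/sW//]; rewrite inE vD.
  have [kvs|kvs] := ltnP (size (v :: s)) k; last first.
    left; exists (v :: s); split=> //; last by apply/eqP; rewrite eqn_leq kvs andbT.
    by move=> x /svs /setDP[].
  apply: (IHf (v :: s)) => //; last by move: fk kvs; clear => /=; lia.
  by move=> u w uD wW wD; rewrite inE negb_or => /andP[_ ws]; apply: noD.
(* The search cannot be stuck with an empty stack, since [D] has fewer vertices than [W]. *)
case: s => [|x s] in sk us ps sW noD fk nov *.
  have /subsetPn[v vW vD] : ~~ (W \subset D).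
    by apply/negP=> /subset_leq_card; lia.
  by have := nov v; rewrite vW vD.
have /setDP[xW xD] := sW x (mem_head _ _).
move: us => /= /andP[xs us].
right; exists (x |: D), s; split; first split.
- by rewrite subUset sub1set xW.
- by rewrite cardsU1 xD cD.
- by move: sk => /=; lia.
split=> //; first exact: path_sorted ps.
  move=> y ys; have /setDP[yW yD] : y \in W :\: D by apply: sW; rewrite inE ys orbT.
  by rewrite in_setD in_setU1 (negPf yD) yW orbF andbT; apply: contraNneq xs => <-.
move=> u v /setU1P[->|uD] vW; rewrite in_setU1 negb_or => /andP[vx vD] vs.
  by have := nov v; rewrite vW vD in_cons (negPf vx) (negPf vs).
by apply: noD => //; rewrite in_cons negb_or vx.
Qed.

End Graph.

(** * Expanders and long paths in a bipartite graph without an empty m x m pair *)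

Section Bipartite.
Variables (V : finType) (e : rel V) (side : pred V) (W : {set V}) (m : nat).
Implicit Types (A B S Z U : {set V}) (s p : seq V) (b : bool).

Definition part S b := [set v in S | side v == b].

Hypothesis e_sym : symmetric e.
Hypothesis e_side : forall u v, e u v -> side v = ~~ side u.
Hypothesis joined : forall b A B, A \subset part W b -> B \subset part W (~~ b) ->
  m <= #|A| -> m <= #|B| -> exists2 u, u \in A & exists2 v, v \in B & e u v.

Lemma in_part S b v : (v \in part S b) = (v \in S) && (side v == b).
Proof. by rewrite inE. Qed.

Lemma partS A B b : A \subset B -> part A b \subset part B b.
Proof. by move/subsetP=> sAB; apply/subsetP=> v; rewrite !in_part => /andP[/sAB->]. Qed.

Lemma part_sub S b : part S b \subset S.
Proof. by apply/subsetP=> v; rewrite in_part => /andP[]. Qed.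

Lemma card_part S b : #|S| = #|part S b| + #|part S (~~ b)|.
Proof.
rewrite -(cardsID (part S b) S) (setIidPr (part_sub S b)); congr (_ + _).
by apply: eq_card => v; rewrite !inE; case: (v \in S) => //=; rewrite ?andbT; case: (side v) b => [] [].
Qed.

Lemma part_large S : 2 * m <= #|S| -> exists b, m <= #|part S b|.
Proof.
move=> mS; have [t|f] := leqP m #|part S true|; first by exists true.
by exists false; move: mS; rewrite (card_part S true) /=; lia.
Qed.

Lemma few_nonnbrs S b : S \subset part W b -> m <= #|S| ->
  #|part W (~~ b) :\: nbrs e S| < m.
Proof.
move=> SW mS; rewrite ltnNge; apply/negP=> mN.
have [u uS [v /setDP[_ /negP vN] euv]] := joined SW (subsetDl _ _) mS mN.
by apply: vN; apply/nbrsP; exists u.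
Qed.

(* U' is the complement in U of a largest non-expanding set. *)
Lemma expander_core U : U \subset W -> (forall b, 9 * m <= #|part U b|) -> 0 < m ->
  exists U' : {set V}, [/\ U' \subset U, #|U :\: U'| <= 2 * m & expands e U' (2 * m)].
Proof.
move=> UW U9 m0.
(* The bound [4 * m] leaves room for the union of two sets of size at most [2 * m]. *)
pose bad Z := [&& Z \subset U, #|Z| <= 4 * m & #|(nbrs e Z :&: U) :\: Z| <= #|Z|].
have bad0 : bad set0.
  rewrite /bad sub0set cards0 leqn0 cards_eq0 /=; apply/eqP/setP=> v; rewrite !inE /=.
  by apply/negP=> /andP[/exists_inP[u]]; rewrite inE.
case: (@arg_maxnP _ set0 bad (fun Z => #|Z|) bad0) => Z /and3P[ZU Z4 badZ] maxZ.
(* Otherwise [Z] has [m] vertices on one side, and their neighbours miss fewer than [m] vertices of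
   the other side of [U]. But [Z] and its neighbours in [U] number at most [8 * m], against the
   [9 * m] vertices of that side. *)
have Z2 : #|Z| < 2 * m.
  rewrite ltnNge; apply/negP=> /part_large[b mb].
  have := few_nonnbrs (partS b (subset_trans ZU UW)) mb.
  have := U9 (~~ b); have := cards_addU Z (nbrs e Z :&: U).
  have : #|part U (~~ b)| <= #|Z :|: (nbrs e Z :&: U)| + #|part W (~~ b) :\: nbrs e (part Z b)|.
    apply: leq_trans (leq_card_setU _ _); apply: subset_leq_card; apply/subsetP=> v.
    rewrite in_part => /andP[vU sv]; rewrite !in_setU in_setI in_setD in_part (subsetP UW) // sv vU !andbT.
    have [vN|] := boolP (v \in nbrs e (part Z b)); last by rewrite orbT.
    by rewrite (subsetP (nbrsS e (part_sub Z b))) // orbT.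
  lia.
exists (U :\: Z); split; first exact: subsetDl.
  by rewrite setDDr setDv set0U (setIidPr ZU) ltnW.
move=> S SU S0 S2; rewrite leqNgt; apply/negP=> few.
have dSZ : [disjoint S & Z] by move: SU; rewrite subsetD => /andP[].
have cSZ : #|Z :|: S| = #|Z| + #|S|.
  by rewrite cards_addU (setDidPl dSZ).
(* Adding a non-expanding set of [U :\: Z] to [Z] gives a larger bad set, against maximality. *)
have badS : bad (Z :|: S).
  rewrite /bad subUset ZU (subset_trans SU (subsetDl _ _)) cSZ /=; apply/andP; split; first lia.
  apply: leq_trans (_ : #|((nbrs e Z :&: U) :\: Z) :|: ((nbrs e S :&: (U :\: Z)) :\: S)| <= _).
    apply: subset_leq_card; apply/subsetP=> v; rewrite nbrsU => /setDP[/setIP[vN vU]].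
    rewrite in_setU negb_or => /andP[vZ vS]; apply/setUP.
    by case/setUP: vN => vN; [left|right]; rewrite in_setD in_setI ?in_setD ?vZ ?vS vN vU.
  by apply: leq_trans (leq_card_setU _ _) _; lia.
by have := maxZ _ badS; rewrite /= cSZ; move: S0; rewrite -card_gt0; lia.
Qed.

(** Depth-first search is run until [2 * m] vertices are finished. If no path on [k] vertices
    appears, some side holds [m] finished vertices. The opposite side holds at most [m] finished
    ones and fewer than [m] on the stack, so at least [m] are unvisited, and [joined] gives an edge
    that the search excludes. *)
Lemma long_path U k : U \subset W -> (forall b, 3 * m <= #|part U b|) -> 0 < k <= m ->
  exists s, [/\ uniq s, sorted e s, {subset s <= U} & size s = k].
Proof.
move=> UW U3 /andP[k0 km].
have U2 : 2 * m <= #|U| by have := U3 true; have := card_part U true; lia.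
case: (dfs_state e_sym k0 U2) => // -[D [s [[DU cD sk] [us ps sU noD]]]].
have /part_large[b mb] : 2 * m <= #|D| by rewrite cD.
have mB : m <= #|part U (~~ b) :\: (part D (~~ b) :|: [set x in s])|.
  rewrite cardsD; have := card_part D b; have := U3 (~~ b).
  have := subset_leq_card (subsetIr (part U (~~ b)) (part D (~~ b) :|: [set x in s])).
  have := (leq_card_setU (part D (~~ b)) [set x in s]).1.
  have : #|[set x in s]| <= size s by rewrite cardsE card_size.
  lia.
have [] := joined (partS b (subset_trans DU UW)) _ mb mB.
  by apply: subset_trans (subsetDl _ _) (partS _ UW).
move=> u uD [v /setDP[vU]]; rewrite in_setU negb_or inE => /andP[vD vs] euv.
move: vU vD; rewrite !in_part => /andP[vU ->]; rewrite andbT => vD.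
by move: euv; rewrite (negPf (noD u v (subsetP (part_sub D b) _ uD) vU vD vs)).
Qed.

Lemma path_side x p : path e x p -> side (last x p) = side x (+) odd (size p).
Proof.
elim: p x => [|y p IH] x /=; first by rewrite addbF.
by case/andP=> /e_side exy /IH->; rewrite exy addNb addbN.
Qed.

(** A path on [k.+1] vertices yields both starting sides: drop its last vertex or its first. *)
Lemma long_path_from U k b : U \subset W -> (forall b, 3 * m <= #|part U b|) -> 0 < k < m ->
  exists x s, [/\ uniq (x :: s), path e x s, {subset x :: s <= U}, size s = k.-1 & side x = b].
Proof.
move=> UW U3 /andP[k0 km]; have [//|[|x [|y s]] [us ps sU]] := @long_path U k.+1 UW U3.
- by [].
- by case=> k0'; move: k0; rewrite -k0'.
case=> sk; have [sx|sx] := eqVneq (side x) b.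
  exists x, (take k.-1 (y :: s)); split=> //.
  - by rewrite -[x :: _]/(take k.-1.+1 (x :: y :: s)) take_uniq.
  - exact: take_path.
  - by move=> z; rewrite -[x :: _]/(take k.-1.+1 (x :: y :: s)) => /mem_take/sU.
  by rewrite size_takel /=; lia.
move: us ps => /andP[_ us] /andP[/e_side exy ps]; exists y, s; split=> //.
- by move=> z zs; apply: sU; rewrite inE zs orbT.
- by lia.
by rewrite exy; case: (side x) b sx => [] [].
Qed.

(** Large levels [L1] and [L2] are grown from the roots inside [U1] and [U2], and a path in [U0] of
    the right length joins them. *)
Lemma connect_roots U0 U1 U2 r1 r2 d q : 0 < m ->
  U0 \subset W -> U1 \subset W -> U2 \subset W ->
  [disjoint U0 & U1] -> [disjoint U0 & U2] -> [disjoint U1 & U2] ->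
  (forall b, 5 * m <= #|part U0 b|) -> expands e U1 (2 * m) -> expands e U2 (2 * m) ->
  r1 \in U1 -> r2 \in U2 -> 2 * m <= 2 ^ d -> 2 * d + 2 <= q <= m ->
  side r2 = side r1 (+) odd q ->
  exists p, [/\ path e r1 p, last r1 p = r2, size p = q, uniq (r1 :: p)
    & {subset r1 :: p <= U0 :|: U1 :|: U2}].
Proof.
move=> m0 U0W U1W U2W d01 d02 d12 U5 ex1 ex2 rU1 rU2 md /andP[dq qm] sr.
have [j1 [L1 [j1d L1U mL1 pL1]]] := expands_level m0 md rU1 ex1.
have [j2 [L2 [j2d L2U mL2 pL2]]] := expands_level m0 md rU2 ex2.
have Lpart r j (L U : {set V}) : L \subset U -> U \subset W ->
    (forall v, v \in L -> exists p, [/\ path e r p, last r p = v, size p = j,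
        uniq (r :: p) & {subset r :: p <= U}]) -> L \subset part W (side r (+) odd j).
  move=> LU UW pL; apply/subsetP=> v vL; rewrite in_part (subsetP UW) ?(subsetP LU) //=.
  by have [p [/path_side sp <- <- _ _]] := pL _ vL; rewrite sp.
have few1 := few_nonnbrs (Lpart _ _ _ _ L1U U1W pL1) mL1.
have few2 := few_nonnbrs (Lpart _ _ _ _ L2U U2W pL2) mL2.
set N1 := _ :\: _ in few1; set N2 := _ :\: _ in few2.
(* Fewer than [2 * m] vertices are deleted, so [3 * m] remain on each side; those on the side facing
   [L1] or [L2] have a neighbour there. *)
pose U := U0 :\: (N1 :|: N2).
have UU0 : U \subset U0 by apply: subsetDl.
have U3 b : 3 * m <= #|part U b|.
  suff : #|part U0 b| <= #|part U b| + #|N1 :|: N2|.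
    by move: (U5 b) (leq_card_setU N1 N2).1 few1 few2; clear; lia.
  apply: leq_trans (leq_card_setU _ _); apply: subset_leq_card; apply/subsetP=> v.
  by rewrite in_part in_setU in_part in_setD => /andP[-> ->]; rewrite !andbT orNb.
(* The branches use [j1] and [j2] edges and the attachments two more, so the middle path has
   [q - 2 - j1 - j2] edges. *)
have [|x [s [us ps sU ks sx]]] := @long_path_from U (q - 1 - j1 - j2) (~~ (side r1 (+) odd j1))
  (subset_trans UU0 U0W) U3; first by move: j1d j2d dq qm; clear; lia.
have nbr1 : x \in nbrs e L1.
  have /setDP[xU0] := sU x (mem_head _ _); rewrite in_setU negb_or => /andP[+ _].
  by rewrite in_setD in_part sx eqxx (subsetP U0W) // !andbT negbK.
have nbr2 : last x s \in nbrs e L2.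
  have /setDP[lU0] := sU _ (mem_last x s); rewrite in_setU negb_or => /andP[_ +].
  rewrite in_setD in_part (subsetP U0W) // (path_side ps) sx sr ks.
  (* By parity the path that starts opposite [L1] ends opposite [L2]. *)
  have -> : odd (q - 1 - j1 - j2).-1 = odd q (+) odd j1 (+) odd j2.
    have {2}-> : q = j1 + j2 + (q - 1 - j1 - j2).-1.+2 by move: j1d j2d dq; clear; lia.
    by rewrite !oddD /= negbK; case: (odd j1) (odd j2) (odd _) => [] [] [].
  suff -> : ~~ (side r1 (+) odd j1) (+) (odd q (+) odd j1 (+) odd j2)
            == ~~ (side r1 (+) odd q (+) odd j2) by rewrite !andbT negbK.
  by case: (side r1) (odd q) (odd j1) (odd j2) => [] [] [] [].
have [l1 l1L el1] := nbrsP _ _ _ nbr1; have [l2 l2L el2] := nbrsP _ _ _ nbr2.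
have [p1 [pp1 lp1 sp1 up1 inp1]] := pL1 _ l1L; have [p2 [pp2 lp2 sp2 up2 inp2]] := pL2 _ l2L.
have rp2 : rev (r2 :: p2) = l2 :: rev (belast r2 p2) by rewrite lastI rev_rcons lp2.
have inU0 : {subset x :: s <= U0} by move=> z /sU; apply: (subsetP UU0).
exists (p1 ++ (x :: s) ++ rev (r2 :: p2)); split.
- rewrite cat_path pp1 lp1 /= el1 cat_path ps rp2 /= e_sym el2 /= -lp2 rev_path.
  by rewrite (eq_path (e' := e)) // => a b; rewrite e_sym.
- by rewrite !last_cat rev_cons last_rcons.
- by rewrite !size_cat size_rev /= sp1 sp2 ks; move: j1d j2d dq; clear; lia.
- rewrite -cat_cons !cat_uniq up1 us rev_uniq up2 !andbT !andTb; apply/andP; split.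
    apply/hasPn=> z; rewrite mem_cat mem_rev => zin; apply/negP=> /inp1 z1.
    case/orP: zin => [/inU0 z0|/inp2 z2]; last by rewrite (disjointFr d12 z1) in z2.
    by rewrite (disjointFr d01 z0) in z1.
  apply/hasPn=> z; rewrite mem_rev => /inp2 z2; apply/negP=> /inU0 z0.
  by rewrite (disjointFr d02 z0) in z2.
move=> z; rewrite -cat_cons !mem_cat mem_rev !in_setU.
by case/or3P=> [/inp1->|/inU0->|/inp2->]; rewrite ?orbT.
Qed.

End Bipartite.

(** * Cycles of prescribed length through a joined pair of sets *)

Lemma three_disjoint_subsets (V : finType) (A : {set V}) k0 k1 k2 :
  k0 + k1 + k2 <= #|A| ->
  exists A0 A1 A2 : {set V},
    [/\ [/\ A0 \subset A, A1 \subset A & A2 \subset A], [/\ #|A0| = k0, #|A1| = k1 & #|A2| = k2]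
      & [/\ [disjoint A0 & A1], [disjoint A0 & A2] & [disjoint A1 & A2]]].
Proof.
move=> kA; have [|A0 s0 c0] := @subset_of_card _ A k0; first lia.
have cD0 : #|A :\: A0| = #|A| - k0 by rewrite cardsD (setIidPr s0) c0.
have [|A1 s1 c1] := @subset_of_card _ (A :\: A0) k1; first lia.
have cD1 : #|A :\: A0 :\: A1| = #|A| - k0 - k1 by rewrite cardsD (setIidPr s1) c1 cD0.
have [|A2 s2 c2] := @subset_of_card _ (A :\: A0 :\: A1) k2; first lia.
move: s1 s2; rewrite !subsetD => /andP[s1 d1] /andP[/andP[s2 d2] d12].
by exists A0, A1, A2; split; split=> //; rewrite disjoint_sym.
Qed.

Lemma disjoint_setU2 (V : finType) (X Y A A' B B' : {set V}) : [disjoint X & Y] ->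
  A \subset X -> A' \subset X -> B \subset Y -> B' \subset Y ->
  [disjoint A & A'] -> [disjoint B & B'] -> [disjoint A :|: B & A' :|: B'].
Proof.
move=> dXY /subsetP sA /subsetP sA' /subsetP sB /subsetP sB' dA dB.
rewrite disjoint_subset; apply/subsetP=> v vAB; rewrite inE; apply/negP=> /setUP vAB'.
case/setUP: vAB => [vA|vB]; case: vAB' => [vA'|vB'].
- by rewrite (disjointFr dA vA) in vA'.
- by have := sB' _ vB'; rewrite (disjointFr dXY (sA _ vA)).
- by have := sB _ vB; rewrite (disjointFr dXY (sA' _ vA')).
by rewrite (disjointFr dB vB) in vB'.
Qed.

(** [X'] consists of the vertices of [X] outside the three reserved pieces that have neighbours in
    both expander cores. A path between these neighbours closes up through one vertex of [X'] if [n]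
    is even, and through an edge inside [X'] if [n] is odd. *)
Lemma bipartite_cycles (V : finType) (h : rel V) (X Y : {set V}) m d n :
  symmetric h -> [disjoint X & Y] -> 0 < m -> 23 * m <= #|X| -> 23 * m <= #|Y| ->
  2 * m <= 2 ^ d -> 2 * d + 5 <= n <= m ->
  (forall A B : {set V}, A \subset X -> B \subset Y -> m <= #|A| -> m <= #|B| ->
     exists2 u, u \in A & exists2 v, v \in B & h u v) ->
  exists X' : {set V}, [/\ X' \subset X, #|X| <= #|X'| + 25 * m
    & forall u v, u \in X' -> v \in X' -> (if odd n then (u != v) && h u v else u == v) ->
      exists s, [/\ uniq s, cycle h s & size s = n]].
Proof.
move=> h_sym dXY m0 mX mY md /andP[dn nm] hjoin.
pose e u v := h u v && ((u \in X) && (v \in Y) || (u \in Y) && (v \in X)).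
pose side v := v \in X; pose W := X :|: Y.
have XY v : v \in X -> v \in Y = false by move=> vX; rewrite (disjointFr dXY).
have YX v : v \in Y -> v \in X = false by move=> vY; rewrite (disjointFl dXY).
have e_sym : symmetric e by move=> u v; rewrite /e h_sym orbC andbC [(v \in X) && _]andbC
  [(v \in Y) && _]andbC andbC.
have e_side u v : e u v -> side v = ~~ side u.
  rewrite /side; case/andP=> _ /orP[]/andP[uP vP]; last by rewrite vP (YX _ uP).
  by rewrite uP (YX _ vP).
have partW : part side W true = X /\ part side W false = Y.
  split; apply/setP=> v; rewrite in_part in_setU /side.
    by case vX: (v \in X); case: (v \in Y).
  by case vX: (v \in X); [rewrite XY | case: (v \in Y)].
have joined b (A B : {set V}) : A \subset part side W b -> B \subset part side W (~~ b) ->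
    m <= #|A| -> m <= #|B| -> exists2 u, u \in A & exists2 v, v \in B & e u v.
  case: b => /=; rewrite partW.1 partW.2 => sA sB mA mB.
    have [u uA [v vB huv]] := hjoin _ _ sA sB mA mB.
    by exists u => //; exists v => //; rewrite /e huv (subsetP sA) // (subsetP sB).
  have [u uB [v vA huv]] := hjoin _ _ sB sA mB mA.
  exists v => //; exists u => //; rewrite /e h_sym huv (subsetP sA _ vA) (subsetP sB _ uB).
  by rewrite orbT.
(* The piece of size [5 * m] is for the linking path, those of size [9 * m] for the expanders. *)
have [|X0 [X1 [X2 [[sX0 sX1 sX2] [cX0 cX1 cX2] [dX01 dX02 dX12]]]]] :=
  @three_disjoint_subsets _ X (5 * m) (9 * m) (9 * m); first by move: mX; clear; lia.
have [|Y0 [Y1 [Y2 [[sY0 sY1 sY2] [cY0 cY1 cY2] [dY01 dY02 dY12]]]]] :=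
  @three_disjoint_subsets _ Y (5 * m) (9 * m) (9 * m); first by move: mY; clear; lia.
have partU (A B : {set V}) k b : A \subset X -> B \subset Y -> #|A| = k -> #|B| = k ->
    k <= #|part side (A :|: B) b|.
  move=> sA sB cA cB; case: b; [rewrite -cA|rewrite -cB]; apply: subset_leq_card;
    apply/subsetP=> v vS; rewrite in_part in_setU vS ?orbT /side.
    by rewrite (subsetP sA).
  by rewrite YX // (subsetP sB).
have sW (A B : {set V}) : A \subset X -> B \subset Y -> A :|: B \subset W by exact: setUSS.
have [U1 [sU1 cU1 exU1]] := expander_core joined (sW _ _ sX1 sY1)
  (fun b => partU X1 Y1 _ b sX1 sY1 cX1 cY1) m0.
have [U2 [sU2 cU2 exU2]] := expander_core joined (sW _ _ sX2 sY2)
  (fun b => partU X2 Y2 _ b sX2 sY2 cX2 cY2) m0.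
have core_large (U A B : {set V}) : A \subset X -> B \subset Y -> #|A| = 9 * m -> #|B| = 9 * m ->
    #|(A :|: B) :\: U| <= 2 * m -> m <= #|part side U false|.
  move=> sA sB cA cB cU; have := partU A B _ false sA sB cA cB.
  suff : #|part side (A :|: B) false| <= #|part side U false| + #|(A :|: B) :\: U|.
    by move: cU; clear; lia.
  apply: leq_trans (leq_card_setU _ _); apply: subset_leq_card; apply/subsetP=> v.
  by rewrite in_part => /andP[vAB sv]; rewrite in_setU in_part in_setD vAB sv !andbT orbN.
have U1W := subset_trans sU1 (sW _ _ sX1 sY1); have U2W := subset_trans sU2 (sW _ _ sX2 sY2).
have few1 := few_nonnbrs joined (partS side false U1W) (core_large _ _ _ sX1 sY1 cX1 cY1 cU1).
have few2 := few_nonnbrs joined (partS side false U2W) (core_large _ _ _ sX2 sY2 cX2 cY2 cU2).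
set N1 := _ :\: _ in few1; set N2 := _ :\: _ in few2.
(* The pieces take [23 * m] vertices of [X], and each core has fewer than [m] non-neighbours
   there. *)
pose Z := X0 :|: X1 :|: X2 :|: N1 :|: N2.
exists (X :\: Z); split; first exact: subsetDl.
  have cZ : #|Z| <= 25 * m.
    have := (leq_card_setU (X0 :|: X1 :|: X2 :|: N1) N2).1.
    have := (leq_card_setU (X0 :|: X1 :|: X2) N1).1.
    have := (leq_card_setU (X0 :|: X1) X2).1; have := (leq_card_setU X0 X1).1.
    by rewrite cX0 cX1 cX2 -/Z; move: few1 few2; clear; lia.
  by have := cardsID Z X; have := subset_leq_card (subsetIr X Z); move: cZ; clear; lia.
have XZ u : u \in X :\: Z -> [/\ u \in X, u \notin (X0 :|: Y0) :|: U1 :|: U2,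
    exists2 r, r \in part side U1 false & e r u & exists2 r, r \in part side U2 false & e r u].
  rewrite in_setD /Z !in_setU !negb_or => /andP[/andP[/andP[/andP[/andP[u0 u1] u2] uN1] uN2] uX].
  have uY (B : {set V}) : B \subset Y -> u \in B = false.
    by move=> sB; apply/negP=> /(subsetP sB); rewrite XY.
  move: uN1 uN2; rewrite !in_setD !partW.1 uX !andbT !negbK => /nbrsP h1 /nbrsP h2.
  split=> //; rewrite u0 (uY _ sY0) /=.
  apply/andP; split; [apply: contra u1 => /(subsetP sU1)|apply: contra u2 => /(subsetP sU2)];
    by rewrite in_setU (uY _ sY1, uY _ sY2) orbF.
move=> u v /XZ[uX uU [r1 r1U er1] _] /XZ[vX vU _ [r2 r2U er2]] uv.
move: r1U r2U; rewrite !in_part => /andP[r1U /eqP s1] /andP[r2U /eqP s2].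
have d01 := disjoint_setU2 dXY sX0 sX1 sY0 sY1 dX01 dY01.
have d02 := disjoint_setU2 dXY sX0 sX2 sY0 sY2 dX02 dY02.
have d12 := disjoint_setU2 dXY sX1 sX2 sY1 sY2 dX12 dY12.
(* Both roots lie in [Y], so the length must be even: [n - 2] or [n - 3]. *)
have [||p [pp lp sp up inp]] := @connect_roots V e side W m e_sym e_side joined
  (X0 :|: Y0) U1 U2 r1 r2 d (n - 2 - odd n) m0 (sW _ _ sX0 sY0) U1W U2W
  (disjointWr sU1 d01) (disjointWr sU2 d02) (disjointW sU1 sU2 d12)
  (fun b => partU X0 Y0 _ b sX0 sY0 cX0 cY0) exU1 exU2 r1U r2U md.
- by move: dn nm; clear; case: (odd n); lia.
- by rewrite s1 s2; move: dn; clear; lia.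
have eh : subrel e h by move=> x y /andP[].
have notin x : x \notin X0 :|: Y0 :|: U1 :|: U2 -> x \notin r1 :: p.
  by apply: contra; apply: inp.
have pe : path h r1 p by apply: sub_path pp.
case: (odd n) uv sp => [/andP[uv huv]|/eqP uv] sp.
  exists (u :: rcons (r1 :: p) v); split.
  - by rewrite cons_uniq rcons_uniq mem_rcons [_ \in v :: _]in_cons negb_or uv !notin.
  - by rewrite /= !rcons_path pe lp last_rcons h_sym (eh _ _ er1) (eh _ _ er2) /= h_sym huv.
  - by rewrite /= size_rcons sp; move: dn; clear; lia.
exists (u :: r1 :: p); split.
- by rewrite cons_uniq notin.
- by rewrite /= rcons_path pe lp h_sym (eh _ _ er1) uv (eh _ _ er2).
- by rewrite /= sp; move: dn; clear; lia.
Qed.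

(** * The constants and the induction on the number of cycle colours *)

Fixpoint cycle_const t := if t is t'.+1 then cycle_const t' * (25 + cycle_const t') else 2.

Lemma cycle_constS t : cycle_const t.+1 = cycle_const t * (25 + cycle_const t).
Proof. by []. Qed.

Lemma cycle_const_gt1 t : 1 < cycle_const t.
Proof. by elim: t => //= t IH; nia. Qed.

(** Once F is at least 25, the next constant is at most 2 F^2, while the bound squares and gains
    35^2 / 32, which exceeds 2. *)
Lemma cycle_const_bound t : 1 < t -> cycle_const t <= 32 * 35 ^ (2 ^ t - 2).
Proof.
case: t => [|[|t]] // _; elim: t => [//|t IH].
have F25 : 25 <= cycle_const t.+2.
  by have := cycle_const_gt1 t.+1; rewrite [cycle_const t.+2]cycle_constS; nia.
rewrite cycle_constS.
have t2 : 2 <= 2 ^ t.+2 by rewrite !expnS; have := expn_gt0 2 t; lia.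
have -> : 2 ^ t.+3 - 2 = 2 + ((2 ^ t.+2 - 2) + (2 ^ t.+2 - 2)) by rewrite [2 ^ t.+3]expnS; lia.
rewrite !expnD; move: F25 IH; set F := cycle_const _; set E := 35 ^ _.
have -> : 35 ^ 2 = 1225 by [].
by clearbody F E; clear; nia.
Qed.

(** All colours from [t] on count as the bipartite colour, so the induction can merge colour [t]
    into it; [m] and [S] vary because the hypothesis is used twice. *)
Lemma cycles_or_hole (V : finType) (col : V -> V -> nat) (n : nat -> nat) t m d (S : {set V}) :
  (forall x y, col x y = col y x) -> 0 < m ->
  cycle_const t * m <= #|S| -> cycle_const t * m <= 2 ^ d ->
  (forall i, i < t -> 2 * d + 2 <= n i <= m) ->
  (exists2 i, i < t & exists s, [/\ uniq s, cycle (fun x y => col x y == i) s & size s = n i]) \/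
  (exists A B : {set V}, [/\ A \subset S, B \subset S, [disjoint A & B], m <= #|A| & m <= #|B|] /\
    {in A & B, forall a b, t <= col a b}).
Proof.
move=> col_sym; elim: t m S => [|t IH] m S m0 mS md nP.
  (* Without cycle colours any two disjoint sets of size [m] will do. *)
  have [|A sA cA] := @subset_of_card _ S m; first by move: mS => /=; lia.
  right; exists A, (S :\: A); split=> //; split=> //; first exact: subsetDl.
  - by rewrite disjoint_sym; move: (subxx (S :\: A)); rewrite subsetD => /andP[].
  - by rewrite cA.
  - by rewrite cardsD (setIidPr sA) cA; move: mS => /=; lia.
have F2 := cycle_const_gt1 t; move: mS md => /=; set F := cycle_const t in IH F2 *.
rewrite -mulnA => mS md; set m' := _ * m in mS md.
have mm' : m <= m' by rewrite /m'; nia.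
(* First use, with m' = (25 + F) m: after a loss of 25 m, [X] keeps the F m vertices that the second
   use needs. *)
have [i it|[i it [s sP]]|[X [Y [[sX sY dXY mX mY] colXY]]]] := IH m' S (leq_trans m0 mm') mS md.
- by have /andP[-> nm] := nP i (ltnW it); rewrite (leq_trans nm).
- by left; exists i; [apply: ltnW | exists s].
have [/existsP[A /existsP[B /and5P[sA sB mA mB /forall_inP AB]]]|nohole] :=
  boolP [exists A : {set V}, exists B : {set V},
    [&& A \subset X, B \subset Y, m <= #|A|, m <= #|B|
      & [forall a in A, [forall b in B, col a b != t]]]].
  right; exists A, B; split.
    by split=> //; [apply: subset_trans sA sX|apply: subset_trans sB sY|apply: disjointW sA sB dXY].
  move=> a b aA bB; rewrite ltn_neqAle eq_sym colXY ?(subsetP sA) ?(subsetP sB) // andbT.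
  by have /forall_inP := AB _ aA; apply.
have joined (A B : {set V}) : A \subset X -> B \subset Y -> m <= #|A| -> m <= #|B| ->
    exists2 u, u \in A & exists2 v, v \in B & col u v == t.
  move=> sA sB mA mB; move/existsPn/(_ A)/existsPn/(_ B): nohole.
  rewrite sA sB mA mB /= negb_forall_in => /exists_inP[u uA].
  by rewrite negb_forall_in => /exists_inP[v vB]; rewrite negbK; exists u => //; exists v.
have /andP[dn nm] := nP t (ltnSn t).
(* As F (25 + F) is at least 54, the search depth can be [d - 2], which weakens the length
   requirement to [2 * d + 1]. *)
have d2 : 2 * m <= 2 ^ (d - 2) /\ 2 <= d.
  have big : 54 * m <= 2 ^ d by apply: leq_trans md; rewrite /m'; clear -F2; nia.
  case: (d) big => [|[|d']]; rewrite ?expnS; [lia|lia|].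
  by rewrite subn2 /=; lia.
have m23 : 25 * m + F * m <= m' by rewrite /m' mulnDl.
have h_sym : symmetric (fun x y => col x y == t) by move=> x y; rewrite col_sym.
have X23 : 23 * m <= #|X| by move: m23 mX; clear; lia.
have Y23 : 23 * m <= #|Y| by move: m23 mY; clear; lia.
have dn' : 2 * (d - 2) + 5 <= n t <= m by rewrite nm andbT; move: dn d2.2; clear; lia.
have [X' [sX' cX' cyc]] := bipartite_cycles h_sym dXY m0 X23 Y23 d2.1 dn' joined.
have FX' : F * m <= #|X'| by move: cX' mX m23; clear; lia.
have [/existsP[u /existsP[v /and3P[uX vX uv]]]|noedge] := boolP [exists u, exists v,
    [&& u \in X', v \in X' & if odd (n t) then (u != v) && (col u v == t) else u == v]].
  by left; exists t => //; apply: cyc uv.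
(* For even [n t] any single vertex of [X'] would give a cycle, so the claim is vacuous. *)
have nocol u v : u \in X' -> v \in X' -> u != v -> col u v != t.
  move=> uX vX uv; move/existsPn: noedge => noedge.
  have [odd_n|even_n] := boolP (odd (n t)).
    by move/existsPn/(_ v): (noedge u); rewrite uX vX odd_n uv.
  by move/existsPn/(_ u): (noedge u); rewrite uX (negPf even_n) eqxx.
(* Second use, inside [X'], where colour [t] does not occur. *)
have [|i it|[i it [s sP]]|[A [B [[sA sB dAB mA mB] colAB]]]] := IH m X' m0 FX'.
- by apply: leq_trans md; rewrite leq_mul2l mm' orbT.
- by apply: nP; apply: ltnW.
- by left; exists i; [apply: ltnW | exists s].
right; exists A, B; split.
  by split=> //; apply: subset_trans (subset_trans sX' sX).
move=> a b aA bB; rewrite ltn_neqAle eq_sym colAB // andbT.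
apply: nocol; [exact: (subsetP sA)|exact: (subsetP sB)|].
by apply: contraTneq bB => <-; rewrite (disjointFr dAB aA).
Qed.

(** * Monochromatic copies and the Ramsey bound *)

Lemma cycle_mono_copy N k (c : 'I_N -> 'I_N -> 'I_k) (i : 'I_k) s : edge_coloring c ->
  uniq s -> cycle (fun x y => c x y == i) s -> 0 < size s ->
  mono_copy c (cycle_graph (size s)) i.
Proof.
case: s => // x p c_sym us cs _; exists (fun j : 'I_(size (x :: p)) => nth x (x :: p) j); split.
  by move=> j1 j2 /eqP; rewrite nth_uniq // => /eqP /val_inj.
have next (j1 j2 : 'I_(size (x :: p))) : val j2 = (val j1).+1 %% size (x :: p) ->
    c (nth x (x :: p) j1) (nth x (x :: p) j2) = i.
  move=> j12; move/pathP: cs => /(_ x j1); rewrite size_rcons => /(_ (ltn_ord j1))/eqP.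
  have -> : nth x (x :: rcons p x) j1 = nth x (x :: p) j1.
    by rewrite -rcons_cons nth_rcons ltn_ord.
  suff -> : nth x (rcons p x) j1 = nth x (x :: p) j2 by [].
  (* At the last index the successor wraps to 0, matching the [x] appended by [cycle]. *)
  rewrite j12 nth_rcons /=; have := ltn_ord j1; rewrite [size _]/= ltnS leq_eqVlt.
  case/orP=> [/eqP->|lt_j1]; first by rewrite ltnn eqxx modnn.
  by rewrite lt_j1 modn_small.
by move=> j1 j2 /= /orP[]/eqP/next // <-; rewrite c_sym.
Qed.

Lemma hole_mono_copy N k (c : 'I_N -> 'I_N -> 'I_k) (i : 'I_k) (A B : {set 'I_N}) a b :
  edge_coloring c -> [disjoint A & B] -> a <= #|A| -> b <= #|B| ->
  {in A & B, forall x y, c x y = i} -> mono_copy c (Kbip a b) i.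
Proof.
move=> c_sym dAB aA bB cAB.
pose f (u : vert (Kbip a b)) : 'I_N := match u with
  | inl j => enum_val (widen_ord aA j) | inr j => enum_val (widen_ord bB j) end.
have fA j : f (inl j) \in A by apply: enum_valP.
have fB j : f (inr j) \in B by apply: enum_valP.
exists f; split.
  have dis j1 j2 : f (inl j1) <> f (inr j2).
    by move=> e; have := fB j2; rewrite -e (disjointFr dAB).
  case=> j1 [] j2 fe; try by case: (dis _ _ fe); case: (dis _ _ (esym fe)).
  - by move/enum_val_inj: fe => /(congr1 val)/= /val_inj->.
  - by case: (dis _ _ (esym fe)).
  by move/enum_val_inj: fe => /(congr1 val)/= /val_inj->.
by case=> j1 [] j2 // _; [|rewrite c_sym]; apply: cAB.
Qed.

Theorem theorem2p11 (t : nat) (n : nat -> nat) (m1 m2 : nat) :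
  2 <= t -> 0 < m1 -> 0 < m2 ->
  (forall i, i < t -> 0 < n i) ->
  (forall i, i < t ->
     m2 >= n i /\
     n i >= 2 * up_log 2 (35 ^ (2 ^ t - 2) * (32 * m1 + 49 * m2)) + 2) ->
  ramsey_le (cyc_bip_family t n m1 m2) (35 ^ (2 ^ t - 2) * (32 * m1 + 49 * m2)).
Proof.
move=> t2 m1_gt0 m2_gt0 n_gt0 nP; set N := 35 ^ _ * _ in nP *; exists N; split=> [|c c_sym]; first exact: leqnn.
pose m := maxn m1 m2.
(* Both coefficients 32 and 49 are at least 32, so [32 * m] is at most [32 * m1 + 49 * m2]. *)
have FN : cycle_const t * m <= N.
  have := cycle_const_bound t2; rewrite /N; set E := 35 ^ _; move=> FE.
  apply: leq_trans (leq_mul FE (leqnn m)) _; rewrite mulnAC mulnC leq_mul2l.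
  by apply/orP; right; rewrite /m; lia.
have [||||i|[i it [s [us cs sn]]]|[A [B [[_ _ dAB mA mB] cAB]]]] :=
  @cycles_or_hole _ (fun x y => val (c x y)) n t m (up_log 2 N) [set: 'I_N].
- by move=> x y; rewrite c_sym.
- by rewrite /m; lia.
- by rewrite cardsT card_ord.
- by apply: leq_trans FN _; apply: up_logP.
- by case/nP=> nm ->; rewrite /m; lia.
- exists (Ordinal (ltnW it : i < t.+1)).
  rewrite /cyc_bip_family /= it -sn; apply: cycle_mono_copy => //.
  by rewrite sn n_gt0.
exists ord_max; rewrite /cyc_bip_family /= ltnn.
apply: (@hole_mono_copy _ _ _ _ A B) => //.
- by apply: leq_trans mA; rewrite leq_maxl.
- by apply: leq_trans mB; rewrite leq_maxr.
(* In ['I_t.+1] the only colour that is at least [t] is [ord_max]. *)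
move=> x y xA yB; apply: val_inj => /=; apply/eqP; rewrite eqn_leq cAB // andbT.
by rewrite -ltnS.
Qed.
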